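(* Let $\zeta\in(0,1]$ and $\mu\in(0,1)$. Let $S_0=0$ and $S_j=S_{j-1}+(\zeta+j)^{-\mu}$ for all integers $j\ge1$, and let $d_j=1$ for all $j\ge0$. Let $F:\mathbb{R}\to\mathbb{R}$ be the function built from $(S_j)$ and $(d_j)$ as described in the context. Let $\theta_0=0$ and let $(\theta_j)_{j\ge1}$ be generated by the Adagrad-like method $$w_k=\left(\zeta+\sum_{j=0}^k\dot F(\theta_j)^2\right)^{\mu},\qquad \theta_{k+1}=\theta_k-\frac{1}{w_k}\dot F(\theta_k),\qquad k=0,1,2,\dots.$$ Then $\lim_j F(\theta_j)=\infty$ and $\inf_j|\dot F(\theta_j)|=1$.
   Context: $\dot F$ denotes the derivative of $F$. For $m>0$ and $d,\delta\in(0,1]$ let $f(\cdot\,;m,d,\delta):[0,m]\to\mathbb{R}$ be given by $$f(\theta;m,d,\delta)=\begin{cases} -d\theta & \theta\in(0,\frac{2-d}{16}m)\\ \frac{8}{m}(\theta-\frac m8)^2-m\frac{-d^2+4d}{32} & \theta\in[\frac{2-d}{16}m,\frac{3}{16}m)\\ -\frac{5m}{16}\exp\left(\frac{5/16}{\theta/m-1/2}+1\right)+m\frac{11+d^2-4d}{32} & \theta\in(\frac{3}{16}m,\frac12 m)\\ m\frac{11+d^2-4d}{32} & \theta=\frac12 m\\ \frac{5m}{16}\exp\left(\frac{-5/16}{\theta/m-1/2}+1\right)+m\frac{11+d^2-4d}{32} & \theta\in(\frac12 m,\frac{13}{16}m)\\ -\frac{8}{m}(\theta-\frac{7m}{8})^2+m\frac{22+d^2-4d}{32}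 & \theta\in[\frac{13}{16}m,\frac{\delta+14}{16}m)\\ -\delta\theta+m\frac{22+d^2+\delta^2-4d+28\delta}{32} & \theta\in[\frac{\delta+14}{16}m,m] \end{cases}$$ and extended to $\theta=0$ and $\theta=\frac{3}{16}m$ by continuity. Given a strictly increasing real sequence $(S_j)_{j\ge0}$ and a sequence $(d_j)_{j\ge 0}$ in $(0,1]$, the function $F$ is defined (recursively in $j$) on $(-\infty,\sup_j S_j)$ by $F(\theta)=-d_0(\theta-S_0)$ for $\theta\le S_0$; $F(\theta)=f(\theta-S_0;S_1-S_0,d_0,d_1)$ for $\theta\in(S_0,S_1]$; and $F(\theta)=f(\theta-S_j;S_{j+1}-S_j,d_j,d_{j+1})+F(S_j)$ for $\theta\in(S_j,S_{j+1}]$, $j=1,2,\dots$. It is defined on all of $\mathbb{R}$ when $\sup_j S_j=\infty$. *)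

(* Defs.v *)
From Stdlib Require Import Reals Lra Lia.
From Coquelicot Require Import Coquelicot.
Open Scope R_scope.

(** The building block f(theta; m, d, delta), meant for 0 <= theta <= m,
    0 < m and d, delta in (0,1]; the thresholds are then increasing, so the
    tests are read in sequence.  The values at theta = 0 and theta = 3m/16,
    which are prescribed by continuity, are those of the first and second
    formulas (see [f_continuous_0] and [f_continuous_3_16]).  The centre m/2
    is a separate case since the exponent divides by theta/m - 1/2. *)
Definition f (theta m d delta : R) : R :=
  if Rlt_dec theta ((2 - d) / 16 * m) then
    - d * theta
  else if Rle_dec theta (3 / 16 * m) then
    8 / m * (theta - m / 8) ^ 2 - m * ((- d ^ 2 + 4 * d) / 32)
  else if Rlt_dec theta (1 / 2 * m) then
    - (5 * m / 16) * exp ((5 / 16) / (theta / m - 1 / 2) + 1)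
    + m * ((11 + d ^ 2 - 4 * d) / 32)
  else if Req_dec_T theta (1 / 2 * m) then
    m * ((11 + d ^ 2 - 4 * d) / 32)
  else if Rlt_dec theta (13 / 16 * m) then
    5 * m / 16 * exp ((- (5 / 16)) / (theta / m - 1 / 2) + 1)
    + m * ((11 + d ^ 2 - 4 * d) / 32)
  else if Rlt_dec theta ((delta + 14) / 16 * m) then
    - (8 / m) * (theta - 7 * m / 8) ^ 2 + m * ((22 + d ^ 2 - 4 * d) / 32)
  else
    - delta * theta
    + m * ((22 + d ^ 2 + delta ^ 2 - 4 * d + 28 * delta) / 32).

Lemma f_continuous_0 (m d delta : R) :
  0 < m -> 0 < d <= 1 -> continuous (fun t => f t m d delta) 0.
Proof.
  intros Hm Hd.
  apply (continuous_ext_loc _ (fun t => - d * t)).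
  - assert (H : 0 < (2 - d) / 16 * m) by (apply Rmult_lt_0_compat; lra).
    generalize (open_lt _ _ H); apply filter_imp; intros t Ht.
    unfold f; destruct (Rlt_dec t ((2 - d) / 16 * m)); [reflexivity | lra].
  - apply (ex_derive_continuous (fun t => - d * t)); auto_derive; exact I.
Qed.

Lemma f_continuous_3_16 (m d delta : R) :
  0 < m -> 0 < d <= 1 -> continuous (fun t => f t m d delta) (3 / 16 * m).
Proof.
  intros Hm Hd.
  set (q := fun t => 8 / m * (t - m / 8) ^ 2 - m * ((- d ^ 2 + 4 * d) / 32)).
  set (e := fun t => - (5 * m / 16) * exp ((5 / 16) / (t / m - 1 / 2) + 1)
                     + m * ((11 + d ^ 2 - 4 * d) / 32)).
  assert (Hlo : (2 - d) / 16 * m < 3 / 16 * m) by nra.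
  assert (Hhi : 3 / 16 * m < 1 / 2 * m) by nra.
  assert (Hx : 3 / 16 * m / m - 1 / 2 = - (5 / 16)) by (field; lra).
  assert (Hfx : f (3 / 16 * m) m d delta = q (3 / 16 * m)).
  { unfold f; destruct (Rlt_dec _ _); [lra |].
    destruct (Rle_dec _ _); [reflexivity | lra]. }
  assert (Hqe : q (3 / 16 * m) = e (3 / 16 * m)).
  { unfold q, e; rewrite Hx.
    replace (5 / 16 / - (5 / 16) + 1) with 0 by field.
    rewrite exp_0; field; lra. }
  assert (Cq : continuous q (3 / 16 * m)).
  { apply (ex_derive_continuous q); unfold q; auto_derive; exact I. }
  assert (Ce : continuous e (3 / 16 * m)).
  { apply (ex_derive_continuous e); unfold e; auto_derive.
    unfold Rdiv, Rminus in Hx; rewrite ?Hx; repeat split; lra. }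
  intros P HP; rewrite Hfx in HP.
  assert (HP' := HP); rewrite Hqe in HP'.
  specialize (Cq P HP); specialize (Ce P HP'); unfold filtermap in *.
  generalize (filter_and _ _ (filter_and _ _ Cq Ce)
    (filter_and _ _ (open_gt _ _ Hlo) (open_lt _ _ Hhi))).
  apply filter_imp; intros t [[Hq He] [H1 H2]].
  unfold f; destruct (Rlt_dec _ _); [lra |].
  destruct (Rle_dec _ _); [exact Hq |].
  destruct (Rlt_dec _ _); [exact He | lra].
Qed.

(** [F] is the function built from the nodes [S] and the slopes [d].  Its
    values on (-oo, sup S) are prescribed; this is all of R if [S] is
    unbounded.  See [built_from_exists] and [built_from_unique]. *)
Definition built_from (S d : nat -> R) (F : R -> R) : Prop :=
  (forall theta, theta <= S 0%nat ->
     F theta = - d 0%nat * (theta - S 0%nat)) /\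
  (forall theta, S 0%nat < theta <= S 1%nat ->
     F theta = f (theta - S 0%nat) (S 1%nat - S 0%nat) (d 0%nat) (d 1%nat)) /\
  (forall (j : nat) theta, (1 <= j)%nat -> S j < theta <= S (j + 1)%nat ->
     F theta = f (theta - S j) (S (j + 1)%nat - S j) (d j) (d (j + 1)%nat)
               + F (S j)).

Lemma built_from_unique (S d : nat -> R) (F G : R -> R) :
  built_from S d F -> built_from S d G ->
  forall (j : nat) theta, theta <= S j -> F theta = G theta.
Proof.
  intros [F0 [F1 F2]] [G0 [G1 G2]] j; induction j as [|j IH]; intros theta H.
  - rewrite F0, G0; trivial.
  - destruct (Rle_dec theta (S j)) as [Hle | Hgt]; [exact (IH _ Hle) |].
    destruct j as [|j].
    + rewrite F1, G1; trivial; lra.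
    + rewrite (F2 (Datatypes.S j)), (G2 (Datatypes.S j));
        try lia; try (rewrite Nat.add_1_r; lra).
      rewrite (IH (S (Datatypes.S j))); lra.
Qed.

(** Auxiliary to existence: the construction carried out up to node [n]. *)
Fixpoint stage (S d : nat -> R) (n : nat) (theta : R) : R :=
  match n with
  | O => - d 0%nat * (theta - S 0%nat)
  | Datatypes.S j =>
      if Rle_dec theta (S j) then stage S d j theta
      else f (theta - S j) (S (j + 1)%nat - S j) (d j) (d (j + 1)%nat)
           + stage S d j (S j)
  end.

Lemma built_from_exists (S d : nat -> R) :
  (forall j, S j < S (j + 1)%nat) -> exists F, built_from S d F.
Proof.
  intros HS.
  assert (mono : forall i j, (i <= j)%nat -> S i <= S j).
  { intros i j H; induction H as [|j H IH]; [lra |].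
    specialize (HS j); rewrite Nat.add_1_r in HS; lra. }
  assert (stable : forall n k theta, (n <= k)%nat -> theta <= S n ->
    stage S d k theta = stage S d n theta).
  { intros n k theta H Ht; induction H as [|k H IH]; [reflexivity |]; simpl.
    destruct (Rle_dec _ _) as [_ | Hn]; [exact IH |].
    specialize (mono _ _ H); lra. }
  set (F := fun theta => real (Lim_seq (fun n => stage S d n theta))).
  assert (HF : forall n theta, theta <= S n -> F theta = stage S d n theta).
  { intros n theta Ht; unfold F.
    rewrite (Lim_seq_ext_loc _ (fun _ => stage S d n theta)).
    - now rewrite Lim_seq_const.
    - exists n; intros k Hk; now apply stable. }
  exists F; split; [| split].
  - intros theta Ht; now rewrite (HF 0%nat).
  - intros theta Ht; rewrite (HF 1%nat) by lra; simpl.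
    destruct (Rle_dec _ _); [lra | ring].
  - intros j theta _ Ht.
    rewrite (HF (Datatypes.S j)) by (rewrite <- Nat.add_1_r; lra); simpl.
    destruct (Rle_dec _ _); [lra |].
    rewrite (HF j (S j)); lra.
Qed.

(* Main.v *)
Require Import Defs.
From Stdlib Require Import Reals Lra Lia Arith.
From Coquelicot Require Import Coquelicot.
Open Scope R_scope.

(** The nodes are laid out so that the method steps from each one exactly onto
    the next.  The function [F] is linear with slope [- d j] in a neighbourhood
    of the node [S j]: the last piece of the block ending there and the first
    piece of the block starting there are both affine with that slope
    ([built_from_linear_near_node]).  With [d j = 1], an iterate sitting on a
    node therefore sees a derivative equal to [-1]; if all iterates up to
    [theta k] are nodes, the accumulated squared gradients sum to [k + 1], and
    the step [1 / w k] is [(zeta + k + 1) ^ (- mu)], which is precisely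
    [S (k + 1) - S k].  By induction [theta k = S k] for every [k].

    So all the sampled derivatives are [-1], although each block climbs in
    between: it rises by half its length ([f_right_end]), whence
    [F (S j) = S j / 2].  Finally [mu < 1] makes the step lengths at least those
    of a harmonic series, so the nodes, and with them the values of [F], tend
    to infinity ([nodes_unbounded]). *)

(** * The two ends of a block *)

Lemma f_near_left_end (t m d delta : R) :
  t < (2 - d) / 16 * m -> Defs.f t m d delta = - d * t.
Proof.
  intros Ht; unfold Defs.f.
  destruct (Rlt_dec t ((2 - d) / 16 * m)); [reflexivity | lra].
Qed.

Lemma f_near_right_end (t m d delta : R) :
  0 < m -> 0 < d -> 0 < delta -> (delta + 14) / 16 * m <= t ->
  Defs.f t m d delta
  = - delta * t
    + m * ((22 + d ^ 2 + delta ^ 2 - 4 * d + 28 * delta) / 32).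
Proof.
  intros Hm Hd Hdelta Ht.
  assert (0 < d * m) by (apply Rmult_lt_0_compat; assumption).
  assert (0 < delta * m) by (apply Rmult_lt_0_compat; assumption).
  unfold Defs.f.
  destruct (Rlt_dec t ((2 - d) / 16 * m)); [lra |].
  destruct (Rle_dec t (3 / 16 * m)); [lra |].
  destruct (Rlt_dec t (1 / 2 * m)); [lra |].
  destruct (Req_dec_T t (1 / 2 * m)); [lra |].
  destruct (Rlt_dec t (13 / 16 * m)); [lra |].
  destruct (Rlt_dec t ((delta + 14) / 16 * m)); [lra | reflexivity].
Qed.

Lemma f_right_end (m d delta : R) :
  0 < m -> 0 < d -> 0 < delta <= 1 ->
  Defs.f m m d delta
  = m * ((22 + d ^ 2 + delta ^ 2 - 4 * d - 4 * delta) / 32).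
Proof.
  intros Hm Hd Hdelta.
  rewrite f_near_right_end; [field | lra .. |].
  assert (delta * m <= 1 * m) by (apply Rmult_le_compat_r; lra); lra.
Qed.

(** * The glued function at its nodes *)

Lemma built_from_first_node (S d : nat -> R) (F : R -> R) :
  built_from S d F -> F (S 0%nat) = 0.
Proof. intros [H0 _]; rewrite H0 by lra; ring. Qed.

(** The first block obeys the same formula as the others since [F] vanishes
    at the first node. *)
Lemma built_from_block (S d : nat -> R) (F : R -> R) :
  built_from S d F -> forall (j : nat) t, S j < t <= S (j + 1)%nat ->
  F t = Defs.f (t - S j) (S (j + 1)%nat - S j) (d j) (d (j + 1)%nat) + F (S j).
Proof.
  intros HF [|j] t Ht.
  - rewrite (built_from_first_node _ _ _ HF), Rplus_0_r.
    destruct HF as [_ [H1 _]]; exact (H1 t Ht).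
  - destruct HF as [_ [_ H2]]; apply H2; [lia | exact Ht].
Qed.

Section Nodes.

Context (S d : nat -> R) (F : R -> R)
  (S_increasing : forall j : nat, S j < S (j + 1)%nat)
  (d_range : forall j : nat, 0 < d j <= 1)
  (F_built : built_from S d F).

Lemma built_from_next_node (j : nat) :
  F (S (j + 1)%nat)
  = (S (j + 1)%nat - S j)
    * ((22 + d j ^ 2 + d (j + 1)%nat ^ 2 - 4 * d j - 4 * d (j + 1)%nat) / 32)
    + F (S j).
Proof.
  assert (HS := S_increasing j).
  assert (Hd := d_range j); assert (Hd' := d_range (j + 1)%nat).
  rewrite (built_from_block _ _ _ F_built j) by lra.
  rewrite f_right_end by lra; reflexivity.
Qed.

Lemma linear_right_of_node (j : nat) (t : R) :
  S j <= t < S j + (S (j + 1)%nat - S j) / 16 ->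
  F t = F (S j) - d j * (t - S j).
Proof.
  intros [[Ht | <-] Ht']; [| ring].
  assert (HS := S_increasing j); assert (Hd := d_range j).
  assert (d j * (S (j + 1)%nat - S j) <= 1 * (S (j + 1)%nat - S j))
    by (apply Rmult_le_compat_r; lra).
  rewrite (built_from_block _ _ _ F_built j) by lra.
  rewrite f_near_left_end by lra; ring.
Qed.

(** Left of the first node [F] is linear everywhere; left of any other node it
    follows the last piece of the preceding block, whose constant term is tied
    to the value at the node by [built_from_next_node]. *)
Lemma linear_left_of_node (j : nat) :
  exists a, a < S j /\
    forall t, a < t <= S j -> F t = F (S j) - d j * (t - S j).
Proof.
  destruct j as [|j].
  - exists (S 0%nat - 1); split; [lra |]; intros t Ht.
    rewrite (built_from_first_node _ _ _ F_built).
    destruct F_built as [H0 _]; rewrite H0 by lra; ring.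
  - rewrite <- (Nat.add_1_r j).
    assert (HS := S_increasing j).
    assert (Hd := d_range j); assert (Hd' := d_range (j + 1)%nat).
    set (m := S (j + 1)%nat - S j).
    set (a := S j + (d (j + 1)%nat + 14) / 16 * m).
    assert (Hm : 0 < m) by (unfold m; lra).
    assert (0 < d (j + 1)%nat * m) by (apply Rmult_lt_0_compat; lra).
    assert (d (j + 1)%nat * m <= 1 * m) by (apply Rmult_le_compat_r; lra).
    exists a; split; [unfold a; unfold m in *; lra |]; intros t Ht.
    rewrite built_from_next_node.
    rewrite (built_from_block _ _ _ F_built j t)
      by (unfold a, m in *; lra).
    rewrite f_near_right_end by (unfold a, m in *; lra).
    field.
Qed.

Lemma built_from_linear_near_node (j : nat) :
  locally (S j) (fun t => F (S j) - d j * (t - S j) = F t).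
Proof.
  assert (HS := S_increasing j).
  destruct (linear_left_of_node j) as [a [Ha Hleft]].
  assert (Hb : S j < S j + (S (j + 1)%nat - S j) / 16) by lra.
  generalize (filter_and _ _ (open_gt _ _ Ha) (open_lt _ _ Hb)).
  apply filter_imp; intros t [Hat Htb]; symmetry.
  destruct (Rle_dec t (S j)) as [Hle | Hgt].
  - apply Hleft; lra.
  - apply linear_right_of_node; lra.
Qed.

Lemma built_from_Derive_node (j : nat) : Derive F (S j) = - d j.
Proof.
  apply is_derive_unique.
  apply (is_derive_ext_loc _ _ _ _ (built_from_linear_near_node j)).
  auto_derive; [exact I | ring].
Qed.

End Nodes.

Lemma built_from_unit_slopes_node (S d : nat -> R) (F : R -> R) :
  S 0%nat = 0 -> (forall j, S j < S (j + 1)%nat) -> (forall j, d j = 1) ->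
  built_from S d F -> forall j, F (S j) = S j / 2.
Proof.
  intros S0 HS Hd HF j; induction j as [|j IH].
  - rewrite (built_from_first_node _ _ _ HF), S0; field.
  - rewrite <- (Nat.add_1_r j).
    rewrite (built_from_next_node S d F HS) by (assumption || intros; rewrite Hd; lra).
    rewrite !Hd, IH; field.
Qed.

(** * Divergence of the nodes *)

Lemma ln_succ_sub_le_Rpower (x mu : R) :
  1 <= x -> mu <= 1 -> ln (x + 1) - ln x <= Rpower x (- mu).
Proof.
  intros Hx Hmu.
  apply Rle_trans with (/ x).
  - assert (Hinv : 0 < / x) by (apply Rinv_0_lt_compat; lra).
    replace (x + 1) with (x * (1 + / x)) by (field; lra).
    rewrite ln_mult by lra.
    assert (ln (1 + / x) <= / x); [| lra].
    rewrite <- (ln_exp (/ x)) at 2.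
    apply Rcomplements.ln_le; [lra | apply exp_ineq1_le].
  - rewrite <- (Rpower_1 x) at 1 by lra.
    rewrite <- Rpower_Ropp.
    apply Rle_Rpower; lra.
Qed.

(** Comparison with [ln], by telescoping: the nodes stay above
    [ln (zeta + j + 1) - ln (zeta + 1)]. *)
Lemma nodes_unbounded (zeta mu : R) (S : nat -> R) :
  0 < zeta -> mu <= 1 -> S 0%nat = 0 ->
  (forall j, S (j + 1)%nat = S j + Rpower (zeta + INR (j + 1)) (- mu)) ->
  is_lim_seq S p_infty.
Proof.
  intros Hzeta Hmu S0 HS.
  assert (Hln : forall j, ln (zeta + INR j + 1) - ln (zeta + 1) <= S j).
  { intros j; induction j as [|j IH].
    - rewrite S0; simpl; rewrite Rplus_0_r; lra.
    - rewrite <- (Nat.add_1_r j), HS.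
      assert (Hstep := ln_succ_sub_le_Rpower (zeta + INR (j + 1)) mu).
      rewrite plus_INR in *; simpl in *.
      assert (Hj := pos_INR j).
      specialize (Hstep ltac:(lra) Hmu).
      rewrite <- !Rplus_assoc in *; lra. }
  apply (is_lim_seq_le_p_loc (fun j => ln (zeta + INR j + 1) - ln (zeta + 1))).
  { exists 0%nat; intros j _; apply Hln. }
  apply (is_lim_seq_minus _ _ p_infty (ln (zeta + 1)));
    [| apply is_lim_seq_const | reflexivity].
  apply (is_lim_comp_seq ln _ p_infty p_infty is_lim_ln_p).
  - exists 0%nat; intros j _; discriminate.
  - apply (is_lim_seq_le_p_loc INR); [| apply is_lim_seq_INR].
    exists 0%nat; intros j _; lra.
Qed.

(** * The iterates *)

Lemma adagrad_iterates_are_nodes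
  (zeta mu : R) (S theta w : nat -> R) (g : R -> R) :
  S 0%nat = 0 ->
  (forall j, S (j + 1)%nat = S j + Rpower (zeta + INR (j + 1)) (- mu)) ->
  (forall j, g (S j) = -1) ->
  theta 0%nat = 0 ->
  (forall k, w k
     = Rpower (zeta + sum_f_R0 (fun j => (g (theta j)) ^ 2) k) mu) ->
  (forall k, theta (k + 1)%nat = theta k - 1 / w k * g (theta k)) ->
  forall k, theta k = S k.
Proof.
  intros S0 HS Hg theta0 Hw Htheta.
  (* The weight [w k] involves the whole history, so the induction is strong. *)
  intros k; induction k as [k IH] using lt_wf_ind.
  destruct k as [|k]; [now rewrite theta0, S0 |].
  rewrite <- (Nat.add_1_r k), Htheta, HS, Hw.
  rewrite (IH k) by lia; rewrite Hg.
  rewrite (sum_eq _ (fun _ => 1)).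
  - rewrite sum_cte, Rmult_1_l, Rpower_Ropp, <- Nat.add_1_r.
    unfold Rdiv; ring.
  - intros i Hi; rewrite (IH i) by lia; rewrite Hg; ring.
Qed.

Theorem proposition3p11 :
  forall (zeta mu : R) (S d : nat -> R) (F : R -> R) (theta w : nat -> R),
    0 < zeta <= 1 ->
    0 < mu < 1 ->
    S 0%nat = 0 ->
    (forall j : nat, (1 <= j)%nat ->
       S j = S (j - 1)%nat + Rpower (zeta + INR j) (- mu)) ->
    (forall j : nat, d j = 1) ->
    built_from S d F ->
    theta 0%nat = 0 ->
    (forall k : nat,
       w k = Rpower (zeta + sum_f_R0 (fun j => (Derive F (theta j)) ^ 2) k) mu) ->
    (forall k : nat,
       theta (k + 1)%nat = theta k - 1 / w k * Derive F (theta k)) ->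
    is_lim_seq (fun j => F (theta j)) p_infty /\
    Inf_seq (fun j => Finite (Rabs (Derive F (theta j)))) = Finite 1.
Proof.
  intros zeta mu S d F theta w Hzeta Hmu S0 HS Hd HF theta0 Hw Htheta.
  assert (HS' : forall j,
    S (j + 1)%nat = S j + Rpower (zeta + INR (j + 1)) (- mu)).
  { intros j; rewrite HS by lia; now rewrite Nat.add_sub. }
  assert (Sinc : forall j, S j < S (j + 1)%nat).
  { intros j; rewrite HS'.
    assert (Hpos := exp_pos (- mu * ln (zeta + INR (j + 1)))).
    unfold Rpower; lra. }
  assert (Hd' : forall j, 0 < d j <= 1) by (intros j; rewrite Hd; lra).
  assert (HD : forall j, Derive F (S j) = -1).
  { intros j; rewrite (built_from_Derive_node S d F Sinc Hd' HF), Hd; ring. }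
  assert (Hnode := adagrad_iterates_are_nodes zeta mu S theta w (Derive F)
                     S0 HS' HD theta0 Hw Htheta).
  split.
  - apply (is_lim_seq_ext (fun j => S j * / 2)).
    { intros j; rewrite Hnode.
      now rewrite (built_from_unit_slopes_node S d F S0 Sinc Hd HF). }
    apply (is_lim_seq_mult _ _ p_infty (/ 2));
      [| apply is_lim_seq_const | apply is_Rbar_mult_p_infty_pos; simpl; lra].
    apply (nodes_unbounded zeta mu); (assumption || lra).
  - assert (HA : forall j, Rabs (Derive F (theta j)) = 1).
    { intros j; rewrite Hnode, HD; apply Rabs_m1. }
    apply is_inf_seq_unique; intros eps.
    assert (He := cond_pos eps).
    split; [intros j | exists 0%nat]; rewrite HA; simpl; lra.
Qed.
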